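(* Let $r\ge0$ and $m,n\ge1$ be integers. Then \[h_n^{(r+1)}(m)=\binom{n+r}{r}\sum_{\substack{i+j=m\\ i,j\ge0}}(-1)^i\,\zeta_r^\star(\{1\}_i)\,\zeta_{n+r}(\{1\}_j).\]
   Context: For positive integers $M,k,n$ the generalized hyperharmonic numbers are \[h_n^{(M)}(k)=\sum_{\substack{1\le n_{M+k-1}<\cdots<n_{M+1}<n_M\\ \le n_{M-1}\le\cdots\le n_1\le n}}\frac{1}{n_M n_{M+1}\cdots n_{M+k-1}}\] (for $k=1$ the condition is just $1\le n_M\le\cdots\le n_1\le n$). $\{1\}_q$ denotes $1$ repeated $q$ times. For a positive integer $N$, $\zeta_N(\{1\}_j)=\sum_{N\ge n_1>\cdots>n_j\ge1}\frac{1}{n_1\cdots n_j}$ and $\zeta_N^\star(\{1\}_i)=\sum_{N\ge n_1\ge\cdots\ge n_i\ge1}\frac{1}{n_1\cdots n_i}$, with empty-argument values $1$ and $\zeta_N(\{1\}_j)=0$ if $N<j$. For $N=0$: $\zeta_0^\star(\emptyset)=1$ and $\zeta_0^\star(\{1\}_i)=0$ for $i\ge1$. *)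

(* Defs.v *)
From mathcomp Require Import all_boot all_order all_algebra.

Set Implicit Arguments.
Unset Strict Implicit.
Unset Printing Implicit Defensive.

Import Order.TTheory GRing.Theory Num.Theory.
Local Open Scope ring_scope.

(* In all three sums a tuple [t] lists the summation indices n_1, n_2, ... in *)
(* this order; the upper bound on them is enforced by the ordinal type and    *)
(* the lower bound 1 by [all (leq 1)].                                        *)

Definition mzeta1 (N j : nat) : rat :=
  \sum_(t : j.-tuple 'I_N.+1 |
          all (leq 1) [seq val x | x <- t] && sorted gtn [seq val x | x <- t])
    \prod_(x <- t) (val x)%:R^-1.

Definition mzeta1_star (N i : nat) : rat :=
  \sum_(t : i.-tuple 'I_N.+1 |
          all (leq 1) [seq val x | x <- t] && sorted geq [seq val x | x <- t])
    \prod_(x <- t) (val x)%:R^-1.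

(* h_n^(M)(k), meaningful for M, k > 0: [take M t] is (n_1, ..., n_M) and     *)
(* [drop M.-1 t] is (n_M, ..., n_(M+k-1)), so that n_M belongs to both parts. *)
Definition hyperharmonic (n M k : nat) : rat :=
  \sum_(t : (M + k).-1.-tuple 'I_n.+1 |
          [&& all (leq 1) [seq val x | x <- t],
              sorted geq [seq val x | x <- take M t]
            & sorted gtn [seq val x | x <- drop M.-1 t]])
    \prod_(x <- drop M.-1 t) (val x)%:R^-1.

(* Main.v *)
Require Import Defs.
From mathcomp Require Import all_boot all_order all_algebra.
From mathcomp Require Import ring.
Import Order.TTheory GRing.Theory Num.Theory.
Local Open Scope ring_scope.

(** Write S(r, N, m) for the alternating sum over i + j = m. Since the star
sums satisfy H(r+1, i+1) = H(r, i+1) + H(r+1, i)/(r+1) and the strict ones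
E(N+1, j+1) = E(N, j+1) + E(N, j)/(N+1), we get both
S(r, N, m+1) = S(r+1, N, m+1) + S(r+1, N, m)/(r+1) and
S(r, N+1, m+1) = S(r, N, m+1) + S(r, N, m)/(N+1).
Together with C(N+1, r+1) = C(N, r) (N+1)/(r+1) these make
A(r, n) = C(n+r, r) S(r, n+r, m) satisfy the Pascal-type recurrence
A(r+1, n+1) = A(r+1, n) + A(r, n+1), which is also the recurrence of the
hyperharmonic numbers in (M, n); the boundary values at r = 0 and n = 0
agree. *)

(** The index constraints move into [F], which is 0 where they fail; the sum over all words can then
    be peeled one letter at a time. *)
Definition word_sum (k N : nat) (F : seq nat -> rat) : rat :=
  \sum_(t : k.-tuple 'I_N.+1) F [seq val x | x <- t].

Lemma word_sum0 N F : word_sum 0 N F = F [::].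
Proof.
rewrite /word_sum (big_pred1 [tuple]) // => t.
by rewrite (tuple0 t) /= eqxx.
Qed.

Lemma word_sumS k N F :
  word_sum k.+1 N F = \sum_(0 <= a < N.+1) word_sum k N (fun s => F (a :: s)).
Proof.
rewrite big_mkord /word_sum pair_big /=.
rewrite (reindex (fun p : 'I_N.+1 * k.-tuple 'I_N.+1 => cons_tuple p.1 p.2)) //=.
exists (fun t : k.+1.-tuple 'I_N.+1 => (thead t, behead_tuple t)).
  by move=> [a t] _ /=; rewrite theadE; congr pair; apply/val_inj.
by move=> t _ /=; rewrite [RHS]tuple_eta; apply/val_inj.
Qed.

Lemma eq_word_sum k N F G :
  (forall s, all (leq^~ N) s -> F s = G s) -> word_sum k N F = word_sum k N G.
Proof.
move=> FG; apply: eq_bigr => t _; apply: FG.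
by apply/allP => _ /mapP[x _ ->]; rewrite -ltnS ltn_ord.
Qed.

Lemma word_sum_eq0 k N F : (forall s, F s = 0) -> word_sum k N F = 0.
Proof. by move=> F0; rewrite /word_sum big1. Qed.

Lemma word_sumZ k N c F : word_sum k N (fun s => c * F s) = c * word_sum k N F.
Proof. by rewrite /word_sum mulr_sumr. Qed.

(** Once the first index is fixed, this lowers the bound on the remaining ones to it, turning the
    tail into a sum of the same family. *)
Lemma word_sum_restrict k M N F : (M <= N)%N ->
  (forall s, ~~ all (leq^~ M) s -> F s = 0) -> word_sum k N F = word_sum k M F.
Proof.
move=> leMN; elim: k F => [|k IHk] F F0; first by rewrite !word_sum0.
rewrite !word_sumS (@big_cat_nat _ _ _ M.+1) //= [X in _ + X]big_nat_cond.
rewrite [X in _ + X]big1 ?addr0 => [|a]; last first.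
  rewrite andbT => /andP[ltMa _]; apply: word_sum_eq0 => s.
  by apply: F0; rewrite /= leqNgt ltMa.
rewrite big_nat_cond [RHS]big_nat_cond; apply: eq_bigr => a.
rewrite andbT ltnS => /andP[_ leaM]; apply: IHk => s s_big.
by apply: F0; rewrite /= leaM.
Qed.

Definition strict_term (s : seq nat) : rat :=
  if all (leq 1) s && sorted gtn s then \prod_(x <- s) x%:R^-1 else 0.

Definition star_term (s : seq nat) : rat :=
  if all (leq 1) s && sorted geq s then \prod_(x <- s) x%:R^-1 else 0.

Definition hyper_term (M : nat) (s : seq nat) : rat :=
  if [&& all (leq 1) s, sorted geq (take M s) & sorted gtn (drop M.-1 s)]
  then \prod_(x <- drop M.-1 s) x%:R^-1 else 0.

Lemma mzeta1E N j : mzeta1 N j = word_sum j N strict_term.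
Proof.
rewrite /mzeta1 big_mkcond; apply: eq_bigr => t _.
by rewrite /strict_term big_map.
Qed.

Lemma mzeta1_starE N i : mzeta1_star N i = word_sum i N star_term.
Proof.
rewrite /mzeta1_star big_mkcond; apply: eq_bigr => t _.
by rewrite /star_term big_map.
Qed.

Lemma hyperharmonicE n M k :
  hyperharmonic n M k = word_sum (M + k).-1 n (hyper_term M).
Proof.
rewrite /hyperharmonic big_mkcond; apply: eq_bigr => t _.
by rewrite /hyper_term -map_take -map_drop big_map.
Qed.

Lemma gtn_trans : transitive gtn.
Proof. by move=> y x z /= xy yz; apply: ltn_trans yz xy. Qed.

Lemma geq_trans : transitive geq.
Proof. by move=> y x z /= xy yz; apply: leq_trans yz xy. Qed.

(** By transitivity the head bounds the whole tail, which is the shape [word_sum_restrict]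
    expects. *)
Lemma strict_term_cons a s : strict_term (a.+1 :: s) =
  if all (leq^~ a) s then a.+1%:R^-1 * strict_term s else 0.
Proof.
rewrite /strict_term /= (path_sortedE gtn_trans) big_cons.
have -> : all (gtn a.+1) s = all (leq^~ a) s by [].
by case: (all (leq^~ a) s); rewrite ?andbF //=; case: ifP; rewrite ?mulr0.
Qed.

Lemma star_term_cons a s : star_term (a.+1 :: s) =
  if all (leq^~ a.+1) s then a.+1%:R^-1 * star_term s else 0.
Proof.
rewrite /star_term /= (path_sortedE geq_trans) big_cons.
have -> : all (geq a.+1) s = all (leq^~ a.+1) s by [].
by case: (all (leq^~ a.+1) s); rewrite ?andbF //=; case: ifP; rewrite ?mulr0.
Qed.

(** The two pieces overlap in the entry of index [M], so the weak chain and the strict one join into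
    a single chain. *)
Lemma path_geq_take_drop M a s :
  path geq a (take M.+1 s) -> sorted gtn (drop M s) -> path geq a s.
Proof.
elim: M a s => [|M IHM] a [|x s] //=.
  rewrite take0 /= andbT => -> /=; apply: sub_path => y z /=; exact: ltnW.
by case/andP=> -> /=; apply: IHM.
Qed.

(** With [M.+2] the head is n_1, distinct from n_M: it contributes no factor and only bounds the
    tail. *)
Lemma hyper_term_cons M a s : hyper_term M.+2 (a.+1 :: s) =
  if all (leq^~ a.+1) s then hyper_term M.+1 s else 0.
Proof.
rewrite /hyper_term /=.
have [sa|sa] := boolP (all (leq^~ a.+1) s).
  rewrite (path_sortedE geq_trans).
  suff -> : all (geq a.+1) (take M.+1 s) by [].
  by apply/allP => x /mem_take /(allP sa).
case: ifP => // /and3P[_ st sd]; case/negP: sa.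
have := path_geq_take_drop _ _ _ st sd.
by rewrite (path_sortedE geq_trans) => /andP[].
Qed.

Lemma mzeta1S N j :
  mzeta1 N.+1 j.+1 = mzeta1 N j.+1 + N.+1%:R^-1 * mzeta1 N j.
Proof.
have rec K : mzeta1 K j.+1 = \sum_(0 <= a < K) a.+1%:R^-1 * mzeta1 a j.
  (* A first letter 0 violates the lower bound 1, so its term vanishes. *)
  rewrite mzeta1E word_sumS big_nat_recl // word_sum_eq0 // add0r.
  rewrite big_nat_cond [RHS]big_nat_cond; apply: eq_bigr => a.
  rewrite andbT => /andP[_ ltaK].
  rewrite (@word_sum_restrict _ a) 1?ltnW // => [|s sa]; last first.
    by rewrite strict_term_cons (negPf sa).
  rewrite mzeta1E -word_sumZ; apply: eq_word_sum => s sa.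
  by rewrite strict_term_cons sa.
by rewrite !rec big_nat_recr.
Qed.

Lemma mzeta1_starS N i :
  mzeta1_star N.+1 i.+1 =
  mzeta1_star N i.+1 + N.+1%:R^-1 * mzeta1_star N.+1 i.
Proof.
have rec K :
    mzeta1_star K i.+1 = \sum_(0 <= a < K) a.+1%:R^-1 * mzeta1_star a.+1 i.
  rewrite mzeta1_starE word_sumS big_nat_recl // word_sum_eq0 // add0r.
  rewrite big_nat_cond [RHS]big_nat_cond; apply: eq_bigr => a.
  rewrite andbT => /andP[_ ltaK].
  (* Equal indices are allowed here, so the tail is bounded by [a.+1] and not by [a]. *)
  rewrite (@word_sum_restrict _ a.+1) // => [|s sa]; last first.
    by rewrite star_term_cons (negPf sa).
  rewrite mzeta1_starE -word_sumZ; apply: eq_word_sum => s sa.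
  by rewrite star_term_cons sa.
by rewrite !rec big_nat_recr.
Qed.

Lemma hyperharmonic_sum n M k :
  hyperharmonic n M.+2 k = \sum_(0 <= a < n) hyperharmonic a.+1 M.+1 k.
Proof.
rewrite hyperharmonicE word_sumS big_nat_recl // word_sum_eq0 // add0r.
rewrite big_nat_cond [RHS]big_nat_cond; apply: eq_bigr => a.
rewrite andbT => /andP[_ ltan].
rewrite (@word_sum_restrict _ a.+1) // => [|s sa]; last first.
  by rewrite hyper_term_cons (negPf sa).
rewrite hyperharmonicE; apply: eq_word_sum => s sa.
by rewrite hyper_term_cons sa.
Qed.

Lemma hyperharmonic1 n k : hyperharmonic n 1 k = mzeta1 n k.
Proof.
rewrite hyperharmonicE mzeta1E; apply: eq_word_sum => s _.
by rewrite /hyper_term /strict_term drop0; case: s => //= x s; rewrite take0.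
Qed.

Lemma mzeta1_0 N : mzeta1 N 0 = 1.
Proof. by rewrite mzeta1E word_sum0 /strict_term /= big_nil. Qed.

Lemma mzeta1_star0 N : mzeta1_star N 0 = 1.
Proof. by rewrite mzeta1_starE word_sum0 /star_term /= big_nil. Qed.

Lemma mzeta1_empty j : mzeta1 0 j.+1 = 0.
Proof. by rewrite mzeta1E word_sumS big_nat1 word_sum_eq0. Qed.

Lemma mzeta1_star_empty i : mzeta1_star 0 i.+1 = 0.
Proof. by rewrite mzeta1_starE word_sumS big_nat1 word_sum_eq0. Qed.

Definition alt_conv (r N m : nat) : rat :=
  \sum_(i < m.+1) (-1) ^+ i * mzeta1_star r i * mzeta1 N (m - i).

Lemma alt_conv_star r N m :
  alt_conv r N m.+1 = alt_conv r.+1 N m.+1 + r.+1%:R^-1 * alt_conv r.+1 N m.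
Proof.
(* The terms at i = 0 agree; in the others the sign of the shifted index moves the correction to the
   right-hand side. *)
rewrite /alt_conv big_ord_recl [X in _ = X + _]big_ord_recl.
rewrite !mzeta1_star0 -addrA; congr (_ + _).
rewrite mulr_sumr -big_split; apply: eq_bigr => i _ /=.
rewrite /bump /= add1n subSS mzeta1_starS exprS; ring.
Qed.

Lemma alt_conv_strict r N m :
  alt_conv r N.+1 m.+1 = alt_conv r N m.+1 + N.+1%:R^-1 * alt_conv r N m.
Proof.
rewrite /alt_conv big_ord_recr [X in _ = X + _]big_ord_recr /=.
rewrite subnn !mzeta1_0 addrAC; congr (_ + _).
rewrite mulr_sumr -big_split; apply: eq_bigr => i _ /=.
have leim : (i <= m)%N by rewrite -ltnS.
by rewrite subSn // mzeta1S; ring.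
Qed.

Lemma alt_conv0 N m : alt_conv 0 N m = mzeta1 N m.
Proof.
rewrite /alt_conv big_ord_recl big1 => [|i _].
  by rewrite mzeta1_star0 subn0 addr0 !mul1r.
by rewrite mzeta1_star_empty mulr0 mul0r.
Qed.

(** Raising N and then lowering r adds and removes the same correction, so the value is constant
    along N = r. This is the boundary n = 0. *)
Lemma alt_conv_diag r m : alt_conv r r m.+1 = 0.
Proof.
elim: r => [|r IHr]; first by rewrite alt_conv0 mzeta1_empty.
by rewrite alt_conv_strict -alt_conv_star.
Qed.

Lemma binomial_alt_conv_pascal r N m :
  'C(N.+1, r.+1)%:R * alt_conv r.+1 N.+1 m.+1 =
  'C(N, r.+1)%:R * alt_conv r.+1 N m.+1 + 'C(N, r)%:R * alt_conv r N m.+1.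
Proof.
have binE : 'C(N.+1, r.+1)%:R * N.+1%:R^-1 = 'C(N, r)%:R / r.+1%:R :> rat.
  apply/eqP; rewrite eqr_div ?pnatr_eq0 // -!natrM; apply/eqP.
  by rewrite mulnC -mul_bin_diag mulnC.
(* Everything is expanded in [alt_conv r.+1 N] at [m.+1] and [m]: Pascal's rule matches the former
   coefficients, [binE] the latter. *)
rewrite alt_conv_strict (alt_conv_star r) !mulrDr !mulrA binE binS natrD.
ring.
Qed.

Lemma hyperharmonic_alt_conv r n m :
  hyperharmonic n r.+1 m.+1 = 'C(n + r, r)%:R * alt_conv r (n + r) m.+1.
Proof.
elim: r n => [|r IHr] n.
  by rewrite hyperharmonic1 bin0 mul1r addn0 alt_conv0.
rewrite hyperharmonic_sum; elim: n => [|n IHn].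
  by rewrite big_nil add0n alt_conv_diag mulr0.
(* [IHn] evaluates the partial sum and [IHr] the last term, both at N = n + r + 1. *)
rewrite big_nat_recr //= IHn IHr addSnnS -binomial_alt_conv_pascal.
by rewrite addSn.
Qed.

Theorem theorem2p8 (r m n : nat) (hm : (1 <= m)%N) (hn : (1 <= n)%N) :
  hyperharmonic n r.+1 m =
  'C(n + r, r)%:R *
  \sum_(i < m.+1) \sum_(j < m.+1 | (i + j)%N == m)
    (-1) ^+ i * mzeta1_star r i * mzeta1 (n + r) j.
Proof.
case: m hm => // m _; rewrite hyperharmonic_alt_conv; congr (_ * _).
apply: eq_bigr => i _.
(* Only j = m + 1 - i survives, which is [rev_ord i]. *)
rewrite (big_pred1 (rev_ord i)) /= => [|j]; first by rewrite subSS.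
have leim : (i <= m.+1)%N by rewrite -ltnS.
by rewrite -[RHS]val_eqE /= subSS -(eqn_add2l i j) subnKC.
Qed.
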